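(* Let $\mathcal{F}:\mathbb{R}^n\to\mathbb{R}$ be a symmetric function (i.e., $\mathcal{F}(\mathbf{v})=\mathcal{F}(-\mathbf{v})$) which, on streams of length $m=\mathrm{poly}(n)$, takes values in $\left[\frac{1}{\mathrm{poly}(m)},\mathrm{poly}(m)\right]$, and which satisfies the $\beta$-approximate triangle inequality for a constant $\beta>0$. Let $\kappa>2\beta+1$ be a fixed constant, and suppose there is a non-adaptive turnstile streaming algorithm that, for any $\delta\in(0,1)$, uses $S(n)\cdot\log\frac{1}{\delta}$ bits of space and with probability at least $1-\delta$ outputs a $\kappa$-approximation to $\mathcal{F}$ of the frequency vector. Then for any constant $C>1$ there exists an adversarially robust insertion-deletion streaming algorithm on streams of length $m$ that uses $\tilde{O}(n^{1/C})\cdot S(n)$ bits of space and with high probability outputs, at all times $t\in[m]$, a $\kappa^{O(C)}$-approximation to $\mathcal{F}(\mathbf{x}^{(t)})$.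
   Context: A function $\mathcal{F}$ satisfies the $\beta$-approximate triangle inequality if $\mathcal{F}(\mathbf{x}-\mathbf{z})\le\beta\,(\mathcal{F}(\mathbf{x}-\mathbf{y})+\mathcal{F}(\mathbf{y}-\mathbf{z}))$ for all $\mathbf{x},\mathbf{y},\mathbf{z}\in\mathbb{R}^n$. A $\kappa$-approximation to a value $F>0$ is a value in $[F,\kappa F]$. Turnstile (insertion-deletion) stream: a sequence of updates $u_t=(a_t,\Delta_t)$, $t\in[m]$, with $a_t\in[n]$, $\Delta_t\in\mathbb{Z}$, $|\Delta_t|\le\mathrm{poly}(n)$; the prefix frequency vector is $\mathbf{x}^{(t)}$ with $x^{(t)}_i=\sum_{s\le t:\,a_s=i}\Delta_s$. A non-adaptive algorithm is one whose guarantee holds for a stream fixed in advance, independent of its randomness. Adversarial robustness: the stream is produced by an adaptive adversary that chooses each update $u_t$ as a function of all previous updates and all previous outputs of the algorithm; the one-pass algorithm must be correct at all times against every such adversary. *)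

(* Defs.v *)
From HB Require Import structures.
From mathcomp Require Import all_boot all_order all_algebra.
From mathcomp Require Import reals exp.

Set Implicit Arguments.
Unset Strict Implicit.
Unset Printing Implicit Defensive.

Import Order.TTheory GRing.Theory Num.Theory.
Local Open Scope ring_scope.

(** * Asymptotic notation *)

Definition poly_bounded (f : nat -> nat) : Prop :=
  exists k : nat, forall n : nat, (f n <= n ^ k + k)%N.

Definition log2 (R : realType) (x : R) : R := ln x / ln 2.

(* g = O~(f).  The argument of the logarithm is n + 1 so that the bound is
   meaningful at n = 1. *)
Definition softO (R : realType) (g f : nat -> R) : Prop :=
  exists (K : R) (k : nat), forall n : nat, (0 < n)%N ->
    g n <= K * f n * log2 n.+1%:R ^+ k.

(** * Turnstile streams *)

Definition update (n : nat) : Type := ('I_n * int)%type.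

Definition valid_update (M n : nat) (u : update n) : bool := (`|u.2| <= M)%N.

(* Streams of length at most m; as null updates are allowed, their frequency
   vectors are also those of the streams of length exactly m (when n > 0). *)
Definition valid_stream (M n m : nat) (us : seq (update n)) : bool :=
  (size us <= m)%N && all (@valid_update M n) us.

Definition freq (R : realType) (n : nat) (us : seq (update n)) : 'rV[R]_n :=
  \row_i \sum_(u <- us | u.1 == i) (u.2)%:~R.

(** * The functions to be estimated *)

Definition symmetric_fun (R : realType) (n : nat) (F : 'rV[R]_n -> R) : Prop :=
  forall v, F v = F (- v).

Definition approx_triangle (R : realType) (n : nat) (beta : R)
    (F : 'rV[R]_n -> R) : Prop :=
  forall x y z, F (x - z) <= beta * (F (x - y) + F (y - z)).

(* F takes values in [1/poly(m), poly(m)], with a polynomial that does not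
   depend on n. *)
Definition poly_range (R : realType) (M m : nat -> nat)
    (F : forall n : nat, 'rV[R]_n -> R) : Prop :=
  exists k : nat, forall n : nat, (0 < n)%N ->
  forall us : seq (update n), valid_stream (M n) (m n) us ->
    let P : R := (m n ^ k + k)%N%:R in
    P^-1 <= F n (freq R us) <= P.

Definition is_approx (R : realType) (kappa v y : R) : bool :=
  v <= y <= kappa * v.

(** * Randomized one-pass algorithms *)

(* Between two updates the only thing retained is an element of [state].  In
   round t (round 0 being the initialization) the algorithm draws a fresh
   uniform element of [coin], which it may use to update its state and then to
   answer; randomness that has to be remembered must be stored in the state. *)
Record algorithm (R : realType) (n : nat) := Algorithm {
  state : finType;
  coin : finType;
  coin_gt0 : (0 < #|coin|)%N;
  init : coin -> state;
  step : coin -> state -> update n -> state;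
  output : coin -> state -> R }.

(* The number of bits needed to store a state. *)
Definition bits (R : realType) (n : nat) (A : algorithm R n) : nat :=
  up_log 2 #|state A|.

Section Execution.
Variables (R : realType) (n : nat) (A : algorithm R n).

(* The coins of rounds 0, ..., m. *)
Definition coins (m : nat) : finType := {ffun 'I_m.+1 -> coin A}.

Definition prob (m : nat) (E : pred (coins m)) : R :=
  #|E|%:R / #|coins m|%:R.

Variables (m : nat) (w : coins m).

(* Process us from state s, t rounds having already been played. *)
Fixpoint run_from (t : nat) (s : state A) (us : seq (update n)) : state A :=
  if us is u :: us' then run_from t.+1 (step (w (inord t.+1)) s u) us' else s.

(* The output just after the stream us. *)
Definition answer (us : seq (update n)) : R :=
  output (w (inord (size us))) (run_from 0 (init (w ord0)) us).

(* The outputs at the times 1, ..., size us. *)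
Definition answers (us : seq (update n)) : seq R :=
  [seq answer (take t us) | t <- iota 1 (size us)].

(* The first t updates produced by an adversary, which maps the previous
   updates and outputs to the next update. *)
Fixpoint adaptive_stream (adv : seq (update n) -> seq R -> update n) (t : nat)
    : seq (update n) :=
  if t is t'.+1 then
    let us := adaptive_stream adv t' in rcons us (adv us (answers us))
  else [::].

End Execution.

(* The streams are quantified outside of the probability. *)
Definition nonadaptive_correct (R : realType) (n M m : nat)
    (F : 'rV[R]_n -> R) (kappa delta : R) (A : algorithm R n) : Prop :=
  forall us : seq (update n), valid_stream M m us ->
    1 - delta <=
      prob [pred w : coins A m | is_approx kappa (F (freq R us)) (answer w us)].

(* The stream now depends on the coins, through the outputs; t : 'I_m stands
   for the time t + 1. *)
Definition robustly_correct (R : realType) (n M m : nat)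
    (F : 'rV[R]_n -> R) (kappa delta : R) (A : algorithm R n) : Prop :=
  forall adv : seq (update n) -> seq R -> update n,
    (forall us ys, valid_update M (adv us ys)) ->
    1 - delta <=
      prob [pred w : coins A m | [forall t : 'I_m,
        let us := adaptive_stream w adv t.+1 in
        is_approx kappa (F (freq R us)) (answer w us)]].

(* Main.v *)
(* Fix a vector y and an unrevealed sketch of y.  If F(y + z0) is known, then
   for any other z the two triangle inequalities
     F(y + z) <= beta (F(z - z0) + F(y + z0)),
     F(z - z0) <= beta (F(y + z) + F(y + z0))
   determine F(y + z) up to a constant from F(z - z0), unless F(y + z) is much
   smaller than F(y + z0).  In that case z becomes the new anchor z0; as the
   values of F are polynomially bounded, this happens only O(log m) times, and
   every drop can be charged to a sketch of its own.  Taking for y a prefix of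
   the stream and for z the updates of the current block, the quantity
   F(z - z0) is that of the stream started at the anchor, so it is estimated
   recursively on streams as short as the block.  With h = O(C) levels of
   n^(1/C) blocks this multiplies the approximation by kappa^4 per level.

   A sketch is never seen before the single time at which it reports a drop.
   Hence, all other coins being fixed, the stream up to that time does not
   depend on the coins of the sketch, and the nonadaptive guarantee applies. *)

Require Import Defs.
From HB Require Import structures.
From mathcomp Require Import all_boot all_order all_algebra.
From mathcomp Require Import reals exp.
From mathcomp Require Import zify ring lra.

Set Implicit Arguments.
Unset Strict Implicit.
Unset Printing Implicit Defensive.

Import Order.TTheory GRing.Theory Num.Theory.
Local Open Scope ring_scope.

(** * Restart times of the levels *)

Section Control.
Local Open Scope nat_scope.
Variables (L : nat -> nat) (q : nat).

(* Level [k] handles the stream started [age] updates ago, in blocks of length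
   [L k].  The last anchored value is at most 2^expt, up to normalization;
   [bound] is the exponent before the current query, [q] meaning that the block
   has no anchor yet.  Level [k.+1] is restarted at each anchor of level [k].
   The sketches of a level are indexed by the block and by [bound], so that
   none of them is consulted again after the query at which the exponent
   drops. *)
Record level := Level { age : nat; bound : nat; expt : nat }.

Definition anchored (k : nat) (x : level) : bool :=
  (L k %| age x) || (expt x < bound x).

(* The exponent reported at level [k] and age [o] by the sketch [(i, b)]. *)
Definition observation := nat -> nat -> nat -> nat -> nat.

Definition enter (obs : observation) (prev : nat -> nat * nat) (r : bool)
    (k : nat) : level :=
  let o := if r then 0 else (prev k).1.+1 in
  let b := if L k %| o then q else (prev k).2 in
  Level o b (minn b (obs k o (o %/ L k) b)).

Fixpoint levels (obs : observation) (prev : nat -> nat * nat) (r : bool)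
    (k : nat) : level :=
  enter obs prev
    (if k is k'.+1 then anchored k' (levels obs prev r k') else r) k.

Fixpoint traj (obs : nat -> observation) (t : nat) : nat -> level :=
  if t is t'.+1 then
    levels (obs t) (fun k => (age (traj obs t' k), expt (traj obs t' k))) false
  else levels (obs 0) (fun=> (0, 0)) true.

(** A level of age 0 opens a block and is therefore anchored, so the initial restart spreads down to
    every level. *)
Lemma levels_new obs prev k :
  levels obs prev true k = enter obs prev true k.
Proof.
elim: k => [//|k IH]; rewrite [LHS]/= -/(levels obs prev true k) IH.
by rewrite {2}/enter /anchored dvdn0.
Qed.

Section Trajectory.
Variable obs : nat -> observation.
Local Notation x := (traj obs).

Lemma traj0_age k : age (x 0 k) = 0.
Proof.
by rewrite /= levels_new.
Qed.

Definition renewed (t k : nat) : bool :=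
  if k is k'.+1 then anchored k' (x t k') else t == 0.

Lemma age_step t k :
  age (x t.+1 k) = if renewed t.+1 k then 0 else (age (x t k)).+1.
Proof. by case: k. Qed.

Lemma age_renewed t k : renewed t k -> age (x t k) = 0.
Proof. by case: t => [|t] r; rewrite ?traj0_age // age_step r. Qed.

Lemma bound_step t k :
  bound (x t.+1 k) = if L k %| age (x t.+1 k) then q else expt (x t k).
Proof. by case: k. Qed.

Lemma exptE t k : expt (x t k) =
  minn (bound (x t k)) (obs t k (age (x t k)) (age (x t k) %/ L k) (bound (x t k))).
Proof. by case: t k => [|t] [|k]. Qed.

Lemma expt_le t k : expt (x t k) <= bound (x t k).
Proof. by rewrite exptE geq_minl. Qed.

Lemma bound_le t k : bound (x t k) <= q.
Proof.
elim: t => [|t IH].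
  suff -> : bound (x 0 k) = if L k %| age (x 0 k) then q else 0 by case: ifP.
  by case: k.
by rewrite bound_step; case: ifP => // _; apply: leq_trans (expt_le t k) IH.
Qed.

Lemma bound_dvd t k : L k %| age (x t k) -> bound (x t k) = q.
Proof.
case: t => [|t] d; last by rewrite bound_step d.
suff -> : bound (x 0 k) = if L k %| age (x 0 k) then q else 0 by rewrite d.
by case: k {d}.
Qed.

Lemma age_top t : age (x t 0) = t.
Proof. by elim: t => [//|t IH]; rewrite age_step /= IH. Qed.

Lemma age_le t k : age (x t k) <= t.
Proof.
by elim: t => [|t IH]; rewrite ?traj0_age // age_step; case: ifP.
Qed.

(** Every block start of level [k] restarts level [k.+1]. *)
Lemma age_mod t k : 0 < L k -> age (x t k.+1) <= age (x t k) %% L k.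
Proof.
move=> L0; elim: t => [|t IH]; first by rewrite traj0_age.
rewrite age_step /=; case: ifP => //; rewrite {1}/anchored.
move=> /norP [nd _]; rewrite age_step in nd *.
case: ifP nd => [_|_ nd]; first by rewrite dvdn0.
suff -> : (age (x t k)).+1 %% L k = (age (x t k) %% L k).+1 by [].
rewrite -addn1 -modnDml addn1 modn_small //.
have := ltn_pmod (age (x t k)) L0; rewrite leq_eqVlt => /predU1P [E|//].
by move: nd; rewrite /dvdn -addn1 -modnDml addn1 E modnn.
Qed.

Lemma age_antitone t k : 0 < L k -> age (x t k.+1) <= age (x t k).
Proof. by move=> L0; apply: leq_trans (age_mod t L0) (leq_mod _ _). Qed.

Lemma birth_const t k t' : t' <= t -> t - age (x t k) <= t' ->
  t' - age (x t' k) = t - age (x t k).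
Proof.
elim: t => [|t IH]; first by rewrite leqn0 => /eqP ->.
rewrite leq_eqVlt => /predU1P [-> //|]; rewrite ltnS => le_t'.
have := age_le t k; rewrite age_step; case: ifP => _ lea; last first.
  by rewrite subSS; exact: IH.
by rewrite subn0 leqNgt ltnS le_t'.
Qed.

(** Inside a block each bound is the preceding exponent, so a drop at [t'] would leave all later
    bounds of the block strictly below the one at [t']. *)
Lemma expt_no_drop t k t' : 0 < L k -> t' < t -> t - age (x t k) <= t' ->
  age (x t' k) %/ L k = age (x t k) %/ L k -> bound (x t' k) = bound (x t k) ->
  expt (x t' k) = bound (x t' k).
Proof.
move=> L0 lt_t le_t' eq_i eq_b; apply/eqP; rewrite eqn_leq expt_le /= {}eq_b.
suff H j : t' + j.+1 <= t -> bound (x (t' + j.+1) k) <= expt (x t' k).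
  by have := H (t - t'.+1); rewrite addnS -addSn subnKC //; apply.
elim: j => [|j IH] le_j.
all: have c t1 : t' <= t1 <= t -> t1 - age (x t1 k) = t - age (x t k)
       by move=> /andP [a b]; apply: birth_const => //; lia.
(* No block starts after [t']: the age grows by one per update while the block index is the same at
   [t'] and [t]. *)
all: have nd j' : t' + j'.+1 <= t -> ~~ (L k %| age (x (t' + j'.+1) k)).
- 1,3: move=> lej; apply/negP => /dvdnP [a aE].
  1,2: have e1 := c t' ltac:(lia); have e2 := c (t' + j'.+1) ltac:(lia).
  1,2: have a1 := age_le t' k; have a2 := age_le (t' + j'.+1) k; have a3 := age_le t k.
  1,2: have : age (x (t' + j'.+1) k) %/ L k <= age (x t k) %/ L k
         by apply: leq_div2r; lia.
  1,2: rewrite -eq_i aE mulnK // leq_divRL // -aE; lia.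
- by rewrite addn1 bound_step -addn1 (negbTE (nd 0 _)).
- rewrite addnS bound_step -addnS (negbTE (nd j.+1 _)) //.
  apply: leq_trans (expt_le _ _) _; apply: IH; lia.
Qed.

End Trajectory.

(* Two executions whose observations differ only in the slot [(k0, i0, b0)]
   of level [k0] born at time [s] cannot be told apart as long as that slot is
   in use: it has not made its exponent drop yet. *)
Lemma traj_agree h B obs1 obs2 k0 i0 b0 s t :
  (forall k, 0 < L k) ->
  (forall obs t' k, t' <= t -> k < h -> age (traj obs t' k) %/ L k < B) ->
  (forall t', t' < t ->
     (forall t'', t'' < t' -> forall k, k < h ->
        traj obs1 t'' k = traj obs2 t'' k) ->
     forall k o i e, k < h -> i < B -> e <= q -> o <= t' ->
       (t' < s) || ((k, i, e) != (k0, i0, b0)) ->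
       obs1 t' k o i e = obs2 t' k o i e) ->
  k0 < h ->
  (forall obs, obs = obs1 \/ obs = obs2 ->
     [/\ t - age (traj obs t k0) = s, age (traj obs t k0) %/ L k0 = i0
       & bound (traj obs t k0) = b0]) ->
  forall t', t' < t -> forall k, k < h -> traj obs1 t' k = traj obs2 t' k.
Proof.
move=> L0 iB Hobs k0h alive; elim/ltn_ind => t' IHt lt_t.
have {}Hobs := Hobs t' lt_t (fun t'' l => IHt t'' l (ltn_trans l lt_t)).
(* At the exceptional slot the exponent equals the bound whatever the sketch reports, since the slot
   is still in use at time [t]. *)
have levelP obs k : obs = obs1 \/ obs = obs2 -> k = k0 -> s <= t' ->
    age (traj obs t' k) %/ L k = i0 -> bound (traj obs t' k) = b0 ->
    expt (traj obs t' k) = b0.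
  move=> /alive [a1 a2 a3] -> le_s i_ b_; rewrite -b_.
  by apply: (@expt_no_drop obs t) => //; rewrite ?a1 ?a2 ?a3.
have step k : k < h -> age (traj obs1 t' k) = age (traj obs2 t' k) ->
    bound (traj obs1 t' k) = bound (traj obs2 t' k) ->
    traj obs1 t' k = traj obs2 t' k.
  move=> kh ea eb.
  suff ee : expt (traj obs1 t' k) = expt (traj obs2 t' k).
    by case: (traj obs1 t' k) (traj obs2 t' k) ea eb ee =>
       [a b c] [a' b' c'] /= -> -> ->.
  have [c|c] := boolP ((t' < s) ||
    ((k, age (traj obs1 t' k) %/ L k, bound (traj obs1 t' k)) != (k0, i0, b0))).
    have [le1 le2 le3] : [/\ age (traj obs1 t' k) %/ L k < B,
        bound (traj obs1 t' k) <= q & age (traj obs1 t' k) <= t'].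
      by split; [apply: iB => //; exact: ltnW|exact: bound_le|exact: age_le].
    by rewrite !exptE Hobs // ?ea ?eb.
  move: c; rewrite negb_or -leqNgt negbK => /andP [le_s /eqP [kE iE bE]].
  rewrite (levelP obs1) ?(levelP obs2) //; [by right|by rewrite -ea|by rewrite -eb|].
  by left.
have ren k : (if k is k'.+1 then traj obs1 t' k' = traj obs2 t' k' else True) ->
    renewed obs1 t' k = renewed obs2 t' k.
  by case: k => [//|k] /= ->.
elim=> [|k IHk] kh; apply: step => //.
- by rewrite !age_top.
- case: t' IHt lt_t {Hobs levelP ren} => [//|t' IHt lt_t].
  by rewrite !bound_step !age_top IHt // ltnW.
- case: t' IHt lt_t {Hobs levelP} ren IHk => [|t' IHt lt_t] ren IHk.
    by rewrite !traj0_age.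
  by rewrite !age_step ren ?IHk ?IHt // ltnW.
- case: t' IHt lt_t {Hobs levelP} ren IHk => [|t' IHt lt_t] ren IHk.
    by rewrite !bound_dvd ?traj0_age.
  by rewrite !bound_step !age_step ren ?IHk ?IHt // ltnW.
Qed.

End Control.

Lemma age_lt (h B q : nat) (obs : nat -> observation) t k :
  (0 < B)%N -> (t < B ^ h)%N -> (k < h)%N ->
  (age (traj (fun k => B ^ (h - k.+1)) q obs t k) < B ^ (h - k))%N.
Proof.
move=> B0 th; elim: k => [|k IH] kh; first by rewrite age_top subn0.
have L0 : (0 < B ^ (h - k.+1))%N by rewrite expn_gt0 B0.
apply: leq_ltn_trans (@age_mod (fun k => B ^ (h - k.+1))%N q obs t k L0) _.
exact: ltn_pmod.
Qed.

Lemma block_lt (h B q : nat) (obs : nat -> observation) t k :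
  (0 < B)%N -> (t < B ^ h)%N -> (k < h)%N ->
  (age (traj (fun k => B ^ (h - k.+1)) q obs t k) %/ B ^ (h - k.+1) < B)%N.
Proof.
move=> B0 th kh; rewrite ltn_divLR ?expn_gt0 ?B0 // -expnS.
by have := age_lt q obs B0 th kh; rewrite subnSK.
Qed.

(** * Executions and frequency vectors *)

Section Runs.
Variables (R : realType) (n m : nat) (A : algorithm R n).

Lemma run_from_rcons (w : coins A m) t s us u :
  run_from w t s (rcons us u) =
  step (w (inord (t + size us).+1)) (run_from w t s us) u.
Proof.
elim: us t s => [|v us IH] t s /=; first by rewrite addn0.
by rewrite IH addSnnS.
Qed.

Lemma answer_ext (w w' : coins A m) us :
  (forall j, (j <= size us)%N -> w (inord j) = w' (inord j)) ->
  answer w us = answer w' us.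
Proof.
move=> E; rewrite /answer E //; congr output.
have -> : ord0 = inord 0 :> 'I_m.+1 by apply: val_inj; rewrite /= inordK.
rewrite E //; elim/last_ind: us E => [//|us u IH] E.
rewrite !run_from_rcons IH ?E ?size_rcons // => j lej.
by apply: E; rewrite size_rcons ltnW.
Qed.

Lemma size_adaptive_stream (w : coins A m) adv t :
  size (adaptive_stream w adv t) = t.
Proof. by elim: t => [//|t IH] /=; rewrite size_rcons IH. Qed.

Lemma take_adaptive_stream (w : coins A m) adv t t' : (t' <= t)%N ->
  take t' (adaptive_stream w adv t) = adaptive_stream w adv t'.
Proof.
elim: t => [|t IH]; first by rewrite leqn0 => /eqP ->.
rewrite leq_eqVlt => /predU1P [->|lt_t].
  by rewrite take_oversize // size_adaptive_stream.
by rewrite /= -cats1 takel_cat ?size_adaptive_stream // IH.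
Qed.

Lemma valid_adaptive_stream (w : coins A m) M adv t :
  (forall us ys, valid_update M (adv us ys)) -> (t <= m)%N ->
  valid_stream M m (adaptive_stream w adv t).
Proof.
move=> Hadv le_t; rewrite /valid_stream size_adaptive_stream le_t /=.
by elim: t {le_t} => [//|t IH] /=; rewrite all_rcons Hadv.
Qed.

Lemma answers_adaptive_stream (w : coins A m) adv t :
  answers w (adaptive_stream w adv t) =
  [seq answer w (adaptive_stream w adv t') | t' <- iota 1 t].
Proof.
rewrite /answers size_adaptive_stream; apply/eq_in_map => t'.
by rewrite mem_iota add1n ltnS => /andP [_ ?]; rewrite take_adaptive_stream.
Qed.

End Runs.

Lemma eq_adaptive_stream (R : realType) (n m : nat) (A : algorithm R n)
    (w w' : coins A m) adv t :
  (forall t', (0 < t' < t)%N ->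
     adaptive_stream w adv t' = adaptive_stream w' adv t' ->
     answer w (adaptive_stream w adv t') = answer w' (adaptive_stream w' adv t')) ->
  adaptive_stream w adv t = adaptive_stream w' adv t.
Proof.
elim: t {-2}t (leqnn t) => [|T IH] [|t] // le_t E /=.
have Es t' : (t' <= t)%N -> adaptive_stream w adv t' = adaptive_stream w' adv t'.
  move=> le_t'; apply: IH; first exact: leq_trans le_t' le_t.
  by move=> t'' /andP [? ?] ?; apply: E => //; apply/andP; split=> //; lia.
rewrite !answers_adaptive_stream Es //; congr (rcons _ (adv _ _)).
apply/eq_in_map => t'; rewrite mem_iota add1n => /andP [t'0 t't].
by apply: E; [rewrite t'0|apply: Es].
Qed.

Section Freq.
Variables (R : realType) (n : nat).

Lemma freq_cat (us vs : seq (update n)) :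
  freq R (us ++ vs) = freq R us + freq R vs.
Proof. by apply/rowP => i; rewrite !mxE big_cat. Qed.

Lemma freq_nil : freq R ([::] : seq (update n)) = 0.
Proof. by apply/rowP => i; rewrite !mxE big_nil. Qed.

Lemma freq_null (i : 'I_n) k : freq R (nseq k ((i, 0) : update n)) = 0.
Proof.
apply/rowP => j; rewrite !mxE big1_seq // => u /andP [_].
by move=> /nseqP [-> _] /=; rewrite mulr0z.
Qed.

End Freq.

Lemma valid_drop (M n m s : nat) (us : seq (update n)) :
  valid_stream M m us -> valid_stream M m (drop s us).
Proof.
move=> /andP [sz /allP v]; apply/andP; split.
  by rewrite size_drop (leq_trans (leq_subr _ _)).
by apply/allP => u /mem_drop /v.
Qed.

(* If two samples can be recombined reversibly, an event that is unlikely
   whenever the second sample is drawn afresh is unlikely. *)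
Lemma resampling (R : realType) (W W' : finType) (f : W -> W' -> W)
    (g : W -> W' -> W') (E : pred W) (d : R) :
  (forall w w', f (f w w') (g w w') = w /\ g (f w w') (g w w') = w') ->
  (0 < #|W'|)%N ->
  (forall w, #|[pred w' | E (f w w')]|%:R <= d * #|W'|%:R) ->
  #|E|%:R <= d * #|W|%:R.
Proof.
move=> fg W0 Ed.
have cardE (P : pred (W * W')) : #|P| = \sum_w #|[pred w' | P (w, w')]|.
  rewrite -sum1_card (eq_bigl (fun x => P (x.1, x.2))); last by case.
  rewrite -(pair_big_dep xpredT (fun w w' => P (w, w')) (fun _ _ => 1%N)) /=.
  by apply: eq_bigr => w _; rewrite sum1_card.
(* The involution maps the pairs with first component in [E] onto the pairs with [E (f w w')], which
   are then counted fibre by fibre. *)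
have inv : involutive (fun x : W * W' => (f x.1 x.2, g x.1 x.2)).
  by case=> w w' /=; have [-> ->] := fg w w'.
have e : (#|E| * #|W'|)%N = \sum_w #|[pred w' | E (f w w')]|.
  rewrite -(cardE [pred x | E (f x.1 x.2)]).
  rewrite -(card_image (inv_inj inv)) -cardX; apply: eq_card => x.
  rewrite !inE andbT -[x in RHS]inv mem_image; last exact: inv_inj.
  by case: x => w w' /=; rewrite !inE /=; have [-> _] := fg w w'.
rewrite -(ler_pM2r (x := #|W'|%:R)) ?ltr0n // -natrM e natr_sum.
apply: le_trans (ler_sum _ (fun w _ => Ed w)) _.
by rewrite sumr_const -[leLHS]mulr_natr [leRHS]mulrAC.
Qed.

(** * The robust algorithm *)

Section Robust.
Variables (R : realType) (n : nat) (A : algorithm R n) (h' B' q m : nat).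
Variables (V : nat -> R) (beta F0 : R).
Local Notation h := h'.+1.
Local Notation B := B'.+1.
Local Notation L := (fun k : nat => (B ^ (h - k.+1))%N).

(** [find] defaults to the length [q] when no threshold before [V q] is large enough. *)
Definition expo (y : R) : nat := find (fun j => y <= V j) (iota 0 q).

Lemma expo_le y : (expo y <= q)%N.
Proof. by rewrite -[leqRHS](size_iota 0) find_size. Qed.

Lemma expoP y : y <= V q -> y <= V (expo y).
Proof.
move=> yq; have [l|l] := ltnP (expo y) q.
  have /(nth_find 0) : has (fun j => y <= V j) (iota 0 q).
    by rewrite has_find size_iota.
  by rewrite nth_iota ?add0n.
suff -> : expo y = q by [].
by apply/eqP; rewrite eqn_leq expo_le.
Qed.

Lemma expo_lt y j : (j < expo y)%N -> V j < y.
Proof.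
move=> l; have := before_find 0 l.
rewrite nth_iota ?add0n; last exact: leq_trans l (expo_le y).
by move/negbT; rewrite -ltNge.
Qed.

(** The triangle inequality unrolled along the levels: [V (e k)] stands for the value at the last
    anchor of level [k], the recursive term for the stream since that anchor, and [F0] for the empty
    stream. *)
Fixpoint estimate (j : nat) (e : nat -> nat) (k : nat) : R :=
  if j is j'.+1 then beta * (estimate j' e k.+1 + V (e k)) else F0.

Lemma eq_estimate j e e' k :
  (forall i, (k <= i < k + j)%N -> e i = e' i) ->
  estimate j e k = estimate j e' k.
Proof.
elim: j k => [//|j IH] k E /=; rewrite E ?(IH k.+1) //; last by lia.
by move=> i Hi; apply: E; lia.
Qed.

Definition slot : finType := ('I_h * 'I_B * 'I_q.+1)%type.
Definition mkslot (k i e : nat) : slot := (inord k, inord i, inord e).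
Definition rcoin : finType := {ffun slot -> coin A}.
(** Each slot sketches the whole stream since its level was last restarted. The bounds are
    recomputed from the stored ages and exponents. *)
Definition rstate : finType :=
  ({ffun slot -> state A} * {ffun 'I_h -> 'I_m.+1 * 'I_q.+1})%type.

Definition renew (c : rcoin) (next : slot -> state A) (o : nat) (z : slot) :
    state A :=
  if o == 0%N then init (c z) else next z.

Definition observe (c : rcoin) (next : slot -> state A) : observation :=
  fun k o i e =>
    let z := mkslot k i e in expo (output (c z) (renew c next o z)).

Definition refresh (c : rcoin) (next : slot -> state A)
    (prev : nat -> nat * nat) (r : bool) : rstate :=
  let x := levels L q (observe c next) prev r in
  ([ffun z : slot => renew c next (age (x z.1.1)) z],
   [ffun k : 'I_h => (inord (age (x k)), inord (expt (x k)))]).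

Definition control (st : rstate) (k : nat) : nat * nat :=
  let x := st.2 (inord k) in (x.1 : nat, x.2 : nat).

Definition rinit (c : rcoin) : rstate :=
  refresh c (fun z => init (c z)) (fun=> (0, 0)%N) true.

Definition rstep (c : rcoin) (st : rstate) (u : update n) : rstate :=
  refresh c (fun z => step (c z) (st.1 z) u) (control st) false.

Definition routput (_ : rcoin) (st : rstate) : R :=
  estimate h (fun k => (control st k).2) 0.

Lemma rcoin_gt0 : (0 < #|rcoin|)%N.
Proof. by rewrite card_ffun expn_gt0 (coin_gt0 A). Qed.

Definition robust : algorithm R n := Algorithm rcoin_gt0 rinit rstep routput.

Lemma card_rstate : #|state robust| =
  (#|state A| ^ (h * B * q.+1) * (m.+1 * q.+1) ^ h)%N.
Proof. by rewrite card_prod !card_ffun !card_prod !card_ord. Qed.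

(* The coins met by a sketch in slot [z] created at time [s]. *)
Definition tape (w : coins robust m) (s : nat) (z : slot) : coins A m :=
  [ffun j : 'I_m.+1 => (w (inord (s + j)) : rcoin) z].

(** The observations in terms of coins and stream alone, so that executions can be compared without
    their states. *)
Definition replay (w : coins robust m) (p : nat -> seq (update n)) (t : nat) :
    observation :=
  fun k o i e =>
    expo (answer (tape w (t - o) (mkslot k i e)) (drop (t - o) (p t))).

(** * The stored state follows the trajectory *)

Section Implementation.
Variables (w : coins robust m) (p : nat -> seq (update n)) (u : nat -> update n).
Hypotheses (p0 : p 0 = [::]) (pS : forall t, p t.+1 = rcons (p t) (u t)).
Local Notation x := (traj L q (replay w p)).
Local Notation st t := (run_from w 0 (init (w ord0) : state robust) (p t)).

Lemma size_p t : size (p t) = t.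
Proof. by elim: t => [|t IH]; rewrite ?p0 // pS size_rcons IH. Qed.

Definition sketch (t s : nat) (z : slot) : state A :=
  run_from (tape w s z) 0 (init (tape w s z ord0)) (drop s (p t)).

Lemma sketch_new t z : (t <= m)%N ->
  sketch t t z = init ((w (inord t) : rcoin) z).
Proof.
by move=> tm; rewrite /sketch drop_oversize ?size_p //= ffunE addn0.
Qed.

Lemma sketch_step t s z : (s <= t)%N -> (t < m)%N ->
  sketch t.+1 s z = step ((w (inord t.+1) : rcoin) z) (sketch t s z) (u t).
Proof.
move=> le_s lt_t; rewrite /sketch pS drop_rcons ?size_p // run_from_rcons.
by rewrite ffunE size_drop size_p inordK ?add0n -?addnS ?addnS ?subnKC //; lia.
Qed.

Lemma answer_sketch t s z : (s <= t)%N -> (t <= m)%N ->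
  answer (tape w s z) (drop s (p t)) =
  output ((w (inord t) : rcoin) z) (sketch t s z).
Proof.
move=> le_s le_t; rewrite /answer ffunE size_drop size_p inordK ?subnKC //.
lia.
Qed.

(** A level either restarts together with all its sketches, or ages by one while its sketches absorb
    the last update. *)
Lemma run_robust t : (t <= m)%N ->
  (forall z, (st t).1 z = sketch t (t - age (x t z.1.1)) z) /\
  (forall k : 'I_h, (st t).2 k = (inord (age (x t k)), inord (expt (x t k)))).
Proof.
have w0 : w ord0 = w (inord 0) by congr (w _); apply: val_inj; rewrite /= inordK.
elim: t => [|t IH] le_t.
  have E k : levels L q (observe (w (inord 0)) (fun z => init ((w (inord 0) : rcoin) z)))
      (fun=> (0, 0)%N) true k = x 0 k.
    rewrite /= !levels_new /enter /replay /observe subnn.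
    by rewrite answer_sketch // sketch_new.
  rewrite p0 w0 /= /rinit /refresh; split=> [z|k]; rewrite ffunE E //.
  by rewrite traj0_age subnn sketch_new.
have {IH} [IHs IHc] := IH (ltnW le_t).
set c : rcoin := w (inord t.+1).
have stS : st t.+1 = rstep c (st t) (u t).
  by rewrite pS run_from_rcons size_p add0n.
set next := fun z => step (c z) ((st t).1 z) (u t).
have ren o (z : slot) : o = 0%N \/ o = (age (x t z.1.1)).+1 ->
    renew c next o z = sketch t.+1 (t.+1 - o) z.
  case=> ->; first by rewrite subn0 sketch_new.
  by rewrite /renew /= subSS sketch_step ?leq_subr // /next IHs.
have E k : (k < h)%N ->
    levels L q (observe c next) (control (st t)) false k = x t.+1 k.
  have ent r k0 : (k0 < h)%N -> enter L q (observe c next) (control (st t)) r k0 =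
     enter L q (replay w p t.+1) (fun k => (age (x t k), expt (x t k))) r k0.
    move=> kh; have ctl : control (st t) k0 = (age (x t k0), expt (x t k0)).
      rewrite /control IHc /= !inordK //.
      - by rewrite ltnS (leq_trans (expt_le _ _ _ _ _)) ?bound_le.
      - by rewrite ltnS (leq_trans (age_le _ _ _ _ _)) // ltnW.
    rewrite /enter ctl /=; congr (Level _ _ (minn _ _)).
    set o := if r then _ else _; rewrite /observe /replay ren; last first.
      by rewrite /mkslot /= inordK // /o; case: (r); [left|right].
    rewrite answer_sketch ?leq_subr //.
  elim: k => [|k IHk] kh; first exact: ent.
  by rewrite [LHS]/= IHk 1?ltnW // ent.
rewrite stS /rstep /refresh; split=> [z|k]; rewrite ffunE E //.
rewrite ren // age_step; case: renewed; by [left|right].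
Qed.

Lemma answer_robust t : (t <= m)%N ->
  answer w (p t) = estimate h (fun k => expt (x t k)) 0.
Proof.
move=> le_t; apply: eq_estimate => k /andP [_ kh].
have [_ E] := run_robust le_t; rewrite /control E /= !inordK //.
by rewrite ltnS (leq_trans (expt_le _ _ _ _ _)) ?bound_le.
Qed.

End Implementation.

(** * Correctness when no query fails *)

Section Correctness.
Variables (F : 'rV[R]_n -> R) (kappa : R) (M : nat).
Hypotheses (symF : symmetric_fun F) (triF : approx_triangle beta F).
Hypotheses (beta_ge : 1 / 2 <= beta) (kappa_gt : 2 * beta + 1 < kappa).
Hypothesis (F0E : F0 = F 0).
Hypothesis (V_double : forall j, V j.+1 = 2 * V j).
Hypothesis (V_range : forall us : seq (update n), valid_stream M m us ->
  forall y, is_approx kappa (F (freq R us)) y -> y <= V q /\ V 0 < 2 * y).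
Hypothesis (V_pos : 0 < V 0).
Hypothesis (F_pos : forall us : seq (update n), valid_stream M m us ->
  0 < F (freq R us)).

Lemma V_homo : {homo V : i j / (i <= j)%N >-> i <= j}.
Proof.
have V_gt0 j : 0 < V j by elim: j => [//|j IH]; rewrite V_double mulr_gt0.
apply: homo_leq => // [a b c|j]; first exact: le_trans.
by rewrite V_double; have := V_gt0 j; lra.
Qed.

(** Rounding up to a threshold loses a factor below 2; at exponent 0 this is the lower end of
    [V_range]. *)
Lemma V_expo us y : valid_stream M m us -> is_approx kappa (F (freq R us)) y ->
  y <= V (expo y) < 2 * y.
Proof.
move=> v a; have [yq V0] := V_range v a; rewrite expoP //=.
case E : (expo y) => [//|j]; rewrite V_double ltr_pM2l //.
by apply: expo_lt; rewrite E.
Qed.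

(** Here [y] is the vector at the anchor and [z] the change since then. [T1] gives the lower bound;
    [T2], which rests on symmetry, bounds [F z] by a multiple of [F (y + z)], because [F y] is not
    much larger. *)
Lemma combine_estimates (y z : 'rV[R]_n) (v zh g : R) :
  0 < F y -> 0 < F z -> 0 < F (y + z) -> 1 <= g ->
  F y <= v -> v < 2 * kappa * F (y + z) -> is_approx g (F z) zh ->
  is_approx (kappa ^+ 4 * g) (F (y + z)) (beta * (zh + v)).
Proof.
move=> Fy Fz Fyz g1 yv vF /andP [z1 z2].
have T1 : F (y + z) <= beta * (F z + F y).
  by have := triF (y + z) y 0; rewrite !subr0 [y + z - y]addrAC subrr add0r.
have T2 : F z <= beta * (F (y + z) + F y).
  have := triF (y + z) 0 y; rewrite subr0 sub0r -(symF y).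
  by rewrite [y + z - y]addrAC subrr add0r.
have bg := beta_ge; have kg := kappa_gt; have b0 : 0 <= beta by lra.
apply/andP; split.
  by apply: le_trans T1 _; rewrite ler_wpM2l // lerD.
set X := F (y + z) in T1 T2 vF Fyz *.
have k2 : 2 < kappa by lra.
have H1 : F z <= beta * (1 + 2 * kappa) * X.
  apply: le_trans T2 _; rewrite -mulrA ler_wpM2l //; lra.
have H2 : zh <= g * (beta * (1 + 2 * kappa) * X).
  by apply: le_trans z2 _; rewrite ler_wpM2l //; lra.
have H3 : v <= g * (2 * kappa * X).
  apply: le_trans (ltW vF) _; rewrite ler_peMl //.
  by rewrite mulr_ge0 ?mulr_ge0 //; lra.
(* At [beta = kappa / 2] the left side is [kappa ^+ 2 * (kappa / 2 + 5 / 4)], below [kappa ^+ 4]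
   once [kappa > 2]. *)
have H4 : beta * (beta * (1 + 2 * kappa) + 2 * kappa) <= kappa ^+ 4.
  have bk : beta <= kappa / 2 by lra.
  apply: (@le_trans _ _ (kappa / 2 * (kappa / 2 * (1 + 2 * kappa) + 2 * kappa))).
    apply: ler_pM => //.
      by rewrite addr_ge0 // mulr_ge0 //; lra.
    by rewrite lerD2r ler_wpM2r //; lra.
  rewrite -subr_ge0.
  have -> : kappa ^+ 4 - kappa / 2 * (kappa / 2 * (1 + 2 * kappa) + 2 * kappa)
    = kappa ^+ 2 * ((kappa - 2) * (kappa + 3 / 2) + 7 / 4).
    by field.
  by rewrite mulr_ge0 ?sqr_ge0 // addr_ge0 // mulr_ge0; lra.
apply: (@le_trans _ _ (beta * (g * (beta * (1 + 2 * kappa) * X) +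
                               g * (2 * kappa * X)))).
  by rewrite ler_wpM2l // lerD.
have -> : beta * (g * (beta * (1 + 2 * kappa) * X) + g * (2 * kappa * X)) =
  beta * (beta * (1 + 2 * kappa) + 2 * kappa) * (g * X) by ring.
rewrite -[leRHS]mulrA ler_wpM2r // mulr_ge0 //; lra.
Qed.

Variables (w : coins robust m) (p : nat -> seq (update n)) (u : nat -> update n).
Hypotheses (p0 : p 0 = [::]) (pS : forall t, p t.+1 = rcons (p t) (u t)).
Hypothesis (pv : forall t, (t <= m)%N -> valid_stream M m (p t)).
Local Notation x := (traj L q (replay w p)).
Local Notation birth t k := (t - age (x t k))%N.
Local Notation X s t := (F (freq R (drop s (p t)))).

Definition queried (t k : nat) : slot :=
  mkslot k (age (x t k) %/ L k) (bound (x t k)).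

Definition query_correct (t k : nat) : bool :=
  let us := drop (birth t k) (p t) in
  is_approx kappa (F (freq R us)) (answer (tape w (birth t k) (queried t k)) us).

Hypothesis good : forall t k, (t <= m)%N -> (k < h)%N -> query_correct t k.

Lemma exptP t k : (t <= m)%N -> (k < h)%N -> exists2 y,
  is_approx kappa (X (birth t k) t) y & expt (x t k) = minn (bound (x t k)) (expo y).
Proof.
by move=> tm kh; eexists; [exact: (good tm kh)|rewrite exptE].
Qed.

(** [birth t k.+1] is the last anchor of level [k]. At an anchor the exponent rounds up a fresh
    overestimate; between anchors neither it nor the two births change. *)
Lemma anchor_le t k : (t <= m)%N -> (k < h)%N ->
  X (birth t k) (birth t k.+1) <= V (expt (x t k)).
Proof.
move=> + kh; have anch t' : (t' <= m)%N -> anchored L k (x t' k) ->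
    X (birth t' k) (birth t' k.+1) <= V (expt (x t' k)).
  move=> tm an; have [y ya ye] := exptP tm kh.
  have /andP [V1 _] := V_expo (valid_drop (birth t' k) (pv tm)) ya.
  have -> : birth t' k.+1 = t' by rewrite age_renewed ?subn0.
  have -> : expt (x t' k) = expo y.
    case/orP: an => [d|lt]; last by move: lt; rewrite ye; lia.
    by rewrite ye (bound_dvd (L := L) d); apply/minn_idPr/expo_le.
  by case/andP: ya => /le_trans + _; apply.
elim: t => [|t IH] tm.
  by apply: anch => //; rewrite /anchored traj0_age dvdn0.
have [/anch|] := boolP (anchored L k (x t.+1 k)); first exact.
move=> na; have := na; rewrite negb_or -leqNgt => /andP [nd le_be].
have eE : expt (x t.+1 k) = expt (x t k).
  have bE : bound (x t.+1 k) = expt (x t k) by rewrite bound_step (negbTE nd).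
  by apply/eqP; rewrite -bE eqn_leq expt_le.
have sE : birth t.+1 k = birth t k.
  rewrite age_step; case: ifP => [r|_]; last by rewrite subSS.
  by move: nd; rewrite (age_renewed r) dvdn0.
by rewrite eE sE age_step /= (negbTE na) subSS; apply: IH; apply: ltnW.
Qed.

(** The exponent never exceeds the one just reported, which overshoots by at most [kappa] from the
    sketch and 2 from rounding. *)
Lemma no_drop_lt t k : (t <= m)%N -> (k < h)%N ->
  V (expt (x t k)) < 2 * kappa * X (birth t k) t.
Proof.
move=> tm kh; have [y ya ye] := exptP tm kh.
have /andP [_ V2] := V_expo (valid_drop (birth t k) (pv tm)) ya.
apply: (@le_lt_trans _ _ (V (expo y))); first by rewrite V_homo // ye geq_minr.
apply: lt_le_trans V2 _; case/andP: ya => _.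
by rewrite -mulrA ler_pM2l.
Qed.

Lemma take_p t t' : (t' <= t)%N -> take t' (p t) = p t'.
Proof.
elim: t => [|t IH]; first by rewrite leqn0 => /eqP ->; rewrite p0.
rewrite leq_eqVlt => /predU1P [->|lt_t].
  by rewrite take_oversize // (size_p p0 pS).
by rewrite pS -cats1 takel_cat ?(size_p p0 pS) // IH.
Qed.

Lemma estimate_approx t j k : (t <= m)%N -> (k + j = h)%N ->
  is_approx (kappa ^+ (4 * j)) (X (birth t k) t)
    (estimate j (fun k => expt (x t k)) k).
Proof.
move=> tm; elim: j k => [|j IH] k kj.
  (* Blocks of the last level have length [B ^ 0 = 1], so the level below it restarts at every
     update and its stream is empty. *)
  have -> : birth t k = t.
    suff -> : age (x t k) = 0%N by rewrite subn0.
    have kE : k = h'.+1 by rewrite -kj addn0.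
    apply/eqP; rewrite -leqn0 kE.
    apply: leq_trans (age_mod _ _ _ _) _; first by rewrite expn_gt0.
    by rewrite subnn expn0 modn1.
  rewrite drop_oversize ?(size_p p0 pS) // freq_nil muln0 expr0 /= F0E.
  by rewrite /is_approx mul1r lexx.
have kh : (k < h)%N by rewrite -kj addnS ltnS leq_addr.
have {}IH := IH k.+1 ltac:(by rewrite addSnnS).
have le_s : (birth t k <= birth t k.+1)%N.
  by apply: leq_sub2l; apply: age_antitone; rewrite expn_gt0.
have le_a : (birth t k.+1 <= t)%N by rewrite leq_subr.
have split_p : freq R (drop (birth t k) (p t)) =
    freq R (drop (birth t k) (p (birth t k.+1))) + freq R (drop (birth t k.+1) (p t)).
  rewrite -freq_cat -{1}(cat_take_drop (birth t k.+1) (p t)) take_p //.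
  rewrite drop_cat (size_p p0 pS).
  move: le_s; rewrite leq_eqVlt => /predU1P [->|->//].
  by rewrite ltnn subnn drop0 [drop _ (p (birth t k.+1))]drop_oversize ?(size_p p0 pS).
have Fp s t' : (t' <= m)%N -> 0 < X s t' by move=> /pv v; apply/F_pos/valid_drop.
rewrite mulnS exprD /= split_p; apply: combine_estimates => //.
- by apply: Fp; apply: leq_trans tm.
- exact: Fp.
- by rewrite -split_p; apply: Fp.
- by rewrite exprn_ege1 //; have := beta_ge; have := kappa_gt; lra.
- exact: anchor_le.
- by rewrite -split_p; apply: no_drop_lt.
Qed.

Lemma robust_approx t : (t <= m)%N ->
  is_approx (kappa ^+ (4 * h)) (F (freq R (p t))) (answer w (p t)).
Proof.
move=> tm; rewrite (answer_robust w p0 pS tm).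
by have := estimate_approx tm (add0n h); rewrite age_top subnn drop0.
Qed.

End Correctness.

(** * Failure probability *)

Section Failure.
Variables (F : 'rV[R]_n -> R) (kappa delta : R) (M : nat).
Variable adv : seq (update n) -> seq R -> update n.
Hypothesis advP : forall us ys, valid_update M (adv us ys).
Hypothesis correctA : nonadaptive_correct M m F kappa delta A.
Hypothesis mh : (m < B ^ h)%N.

Local Notation stream w := (adaptive_stream (w : coins robust m) adv).
Local Notation x w := (traj L q (replay w (stream w))).

Lemma card_wrong us : valid_stream M m us ->
  #|[pred w : coins A m | ~~ is_approx kappa (F (freq R us)) (answer w us)]|%:R
    <= delta * #|coins A m|%:R.
Proof.
move=> v; set P := [pred w : coins A m | is_approx kappa (F (freq R us)) (answer w us)].
have c0 : 0 < #|coins A m|%:R :> R by rewrite ltr0n card_ffun expn_gt0 coin_gt0.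
have := correctA v; rewrite /prob -/P ler_pdivlMr // -(cardC P) natrD.
have -> : #|[predC P]| =
    #|[pred w : coins A m | ~~ is_approx kappa (F (freq R us)) (answer w us)]|.
  by apply: eq_card => w; rewrite !inE.
set a := #|P|%:R; set b := #|_|%:R; lra.
Qed.

(** With slot, birth and query time fixed, the tape that is read no longer depends on the execution,
    as the union bound requires. *)
Definition query_at (w : coins robust m) (z : slot) (s t : nat) : bool :=
  let y := x w t z.1.1 in
  [&& t - age y == s, age y %/ L z.1.1 == z.1.2 & bound y == z.2]%N.

Definition query_wrong (z : slot) (s t : nat) : pred (coins robust m) :=
  [pred w | query_at w z s t &
     ~~ is_approx kappa (F (freq R (drop s (stream w t))))
          (answer (tape w s z) (drop s (stream w t)))].

Lemma answer_stream (w : coins robust m) t : (t <= m)%N ->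
  answer w (stream w t) = estimate h (fun k => expt (x w t k)) 0.
Proof.
exact: (@answer_robust w (stream w)
  (fun t => adv (stream w t) (answers w (stream w t))) erefl (fun=> erefl)).
Qed.

(** The coins differ only where the sketch in [z] born at [s] reads them, so [traj_agree] applies;
    equal trajectories give equal outputs, hence equal adversarial updates. *)
Lemma stream_agree (w w' : coins robust m) z s t : (t <= m)%N ->
  (forall (j : 'I_m.+1) z', (j < s)%N || (z' != z) ->
     (w j : rcoin) z' = (w' j : rcoin) z') ->
  query_at w z s t -> query_at w' z s t -> stream w t = stream w' t.
Proof.
move=> tm ww' a a'.
have streamE t' : (t' <= m)%N ->
    (forall t'', (t'' < t')%N -> forall k, (k < h)%N -> x w t'' k = x w' t'' k) ->
    stream w t' = stream w' t'.
  move=> le_t' E; apply: eq_adaptive_stream => t'' /andP [_ lt_t''] _.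
  rewrite !answer_stream ?(leq_trans (ltnW lt_t'')) //.
  by apply: eq_estimate => k /andP [_ kh]; rewrite E.
apply: (streamE _ tm) => t1 lt1.
have lem t' : (t' < t)%N -> (t' <= m)%N by move=> l; apply: leq_trans (ltnW l) tm.
apply: (@traj_agree L q h B _ _ z.1.1 z.1.2 z.2 s t) => //.
- by move=> k; rewrite expn_gt0.
- by move=> obs t' k le_t' kh; apply: block_lt => //; lia.
- move=> t' lt_t' E k o i e kh iB eq le_o ne.
  have es := streamE t' (lem _ lt_t') E.
  rewrite /replay es; congr expo; apply: answer_ext => j.
  rewrite size_drop size_adaptive_stream subKn // => le_j.
  rewrite !ffunE; apply: ww'; have l := lem _ lt_t'.
  rewrite !inordK; try by lia.
  case/orP: ne => [lt_s|ne]; first by apply/orP; left; lia.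
  apply/orP; right; apply: contraNneq ne => <-.
  by rewrite /mkslot /= !inordK.
- by move=> obs [->|->]; [case/and3P: a|case/and3P: a'] => /eqP ? /eqP ? /eqP ?.
Qed.

Definition splice (z : slot) (s : nat) (w : coins robust m) (v : coins A m) :
    coins robust m :=
  [ffun j : 'I_m.+1 => [ffun z' : slot =>
     if (z' == z) && (s <= j)%N then v (inord (j - s)) else (w j : rcoin) z']].

Definition unsplice (z : slot) (s : nat) (w : coins robust m) (v : coins A m) :
    coins A m :=
  [ffun j : 'I_m.+1 =>
     if (s + j <= m)%N then (w (inord (s + j)) : rcoin) z else v j].

Lemma spliceK z s w v :
  splice z s (splice z s w v) (unsplice z s w v) = w /\
  unsplice z s (splice z s w v) (unsplice z s w v) = v.
Proof.
split; apply/ffunP => j.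
  apply/ffunP => z'; rewrite !ffunE.
  have [/andP [/eqP -> le_s]|//] := boolP ((z' == z) && (s <= j)%N).
  have jm : (j <= m)%N by rewrite -ltnS.
  by rewrite inordK ?subnKC ?jm ?inord_val //; lia.
rewrite [LHS]ffunE; case: ifP => [le_m|nle]; last by rewrite ffunE nle.
by rewrite !ffunE eqxx inordK // leq_addr addKn inord_val.
Qed.

(** All resampled tapes [v] that make this query occur yield the stream of any one of them, [v0], so
    the nonadaptive guarantee for a single stream covers them. *)
Lemma query_wrong_le z s t : (t <= m)%N ->
  #|query_wrong z s t|%:R <= delta * #|coins robust m|%:R.
Proof.
move=> tm; apply: (resampling (spliceK z s)) => [|w].
  by rewrite card_ffun expn_gt0 coin_gt0.
pose P v := query_wrong z s t (splice z s w v).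
have [v0 Pv0|P0] := pickP P; last first.
  rewrite eq_card0 => [|v]; last by rewrite inE; apply: P0.
  (* The empty stream shows that the right-hand side is nonnegative. *)
  have vn : valid_stream M m ([::] : seq (update n)) by [].
  by apply: le_trans (card_wrong vn); rewrite ler0n.
pose us := drop s (stream (splice z s w v0) t).
have vus : valid_stream M m us by apply/valid_drop/valid_adaptive_stream.
apply: le_trans (card_wrong vus); rewrite ler_nat; apply: subset_leq_card.
apply/subsetP => v; rewrite !inE => /andP [a].
have e : stream (splice z s w v) t = stream (splice z s w v0) t.
  apply: (@stream_agree _ _ z s t) => //; last by case/andP: Pv0.
  move=> j z' c; rewrite !ffunE; case: andP => // -[/eqP zz le_s].
  by move: c; rewrite zz eqxx orbF ltnNge le_s.
rewrite e -/us; congr (~~ is_approx _ _ _); apply: answer_ext => j.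
rewrite size_drop size_adaptive_stream => le_j.
have /and3P [/eqP sE _ _] := a.
rewrite !ffunE eqxx /= !inordK; try by lia.
by rewrite leq_addr addKn.
Qed.

End Failure.

(** Union bound over slots, birth times and query times, the last two ranging over [m.+1] values
    each. *)
Lemma robust_robustly_correct (F : 'rV[R]_n -> R) (kappa delta eps : R) (M : nat) :
  symmetric_fun F -> approx_triangle beta F -> 1 / 2 <= beta ->
  2 * beta + 1 < kappa -> F0 = F 0 -> (forall j, V j.+1 = 2 * V j) ->
  (forall us : seq (update n), valid_stream M m us ->
     forall y, is_approx kappa (F (freq R us)) y -> y <= V q /\ V 0 < 2 * y) ->
  0 < V 0 ->
  (forall us : seq (update n), valid_stream M m us -> 0 < F (freq R us)) ->
  (m < B ^ h)%N -> nonadaptive_correct M m F kappa delta A ->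
  (#|slot| * m.+1 ^ 2)%:R * delta <= eps ->
  robustly_correct M m F (kappa ^+ (4 * h)) eps robust.
Proof.
move=> symF triF bg kg F0E Vd Vr V0 Fp mh cA de adv advP.
set G := [pred w | _].
set W := coins robust m in G *.
have W0 : 0 < #|W|%:R :> R by rewrite ltr0n card_ffun expn_gt0 rcoin_gt0.
pose E (i : slot * 'I_m.+1 * 'I_m.+1) := query_wrong F kappa adv i.1.1 i.1.2 i.2.
have EG w : ~~ G w -> exists i, E i w.
  move=> nG; apply/existsP; apply: contraR nG; rewrite negb_exists => /forallP nE.
  apply/forallP => t; apply: (robust_approx symF triF bg kg F0E Vd Vr V0 Fp
    (u := fun t => adv (adaptive_stream w adv t)
                     (answers w (adaptive_stream w adv t)))) => // [t' le_t'|t' k le_t' kh].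
    exact: valid_adaptive_stream.
  set y := traj L q (replay w (adaptive_stream w adv)) t' k.
  have le_s : (t' - age y < m.+1)%N by lia.
  have := nE (queried w (adaptive_stream w adv) t' k, Ordinal le_s,
              Ordinal (le_t' : (t' < m.+1)%N)).
  rewrite /E /query_wrong /= negb_and negbK => /orP [|//].
  rewrite /query_at /= inordK // -/y eqxx /= !inordK ?eqxx //.
    by rewrite ltnS bound_le.
  exact: block_lt (leq_ltn_trans le_t' mh) kh.
have cG : #|[predC G]|%:R <= eps * #|W|%:R.
  apply: (@le_trans _ _ (\sum_i #|E i|%:R)).
    rewrite -natr_sum ler_nat -sum1_card.
    under [leqRHS]eq_bigr do rewrite -sum1_card.
    rewrite (exchange_big_dep predT) //= big_mkcond /=.
    apply: leq_sum => w _; case: ifP => // /EG [i Ei].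
    by rewrite (bigD1 i).
  apply: le_trans (ler_wpM2r (ltW W0) de); rewrite -mulrA.
  apply: (@le_trans _ _ (\sum_(i : slot * 'I_m.+1 * 'I_m.+1) delta * #|W|%:R)).
    by apply: ler_sum => i _; apply: (query_wrong_le advP cA mh); rewrite -ltnS.
  rewrite sumr_const -[leLHS]mulr_natl !card_prod !card_ord -mulnA lexx //.
rewrite /prob ler_pdivlMr //; move: cG; rewrite -(cardC G) natrD.
by set a := #|G|%:R; set b := #|_|%:R => cG; lra.
Qed.

End Robust.

(** * Space and choice of the parameters *)

(* Without memory, the answer to all streams of length [m] is a function of the
   last coin only, so that the values of F are all equal up to kappa. *)
Section Constant.
Variables (R : realType) (n M m : nat) (F : 'rV[R]_n -> R) (kappa : R).

Lemma stateless_ratio (A : algorithm R n) : (0 < n)%N -> bits A = 0%N ->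
  nonadaptive_correct M m F kappa (1 / 4) A ->
  forall us vs, valid_stream M m us -> valid_stream M m vs ->
    F (freq R us) <= kappa * F (freq R vs).
Proof.
move=> n0 A0 cA us vs.
have st s s' : s = s' :> state A.
  have : (#|state A| <= 1)%N.
    by have := up_logP #|state A| (ltnSn 1); rewrite -/(bits A) A0.
  by move/fintype_le1P => /(_ s) /(_ s').
(* Null updates bring both streams to length [m], so that both answers read the coin of round
   [m]. *)
pose pad us := us ++ nseq (m - size us) (Ordinal n0, 0 : int).
have padE us' : freq R (pad us') = freq R us' by rewrite freq_cat freq_null addr0.
have pads us' : valid_stream M m us' -> size (pad us') = m.
  by case/andP => sz _; rewrite size_cat size_nseq subnKC.
have padv us' : valid_stream M m us' -> valid_stream M m (pad us').
  move=> v; rewrite /valid_stream pads // leqnn /= all_cat.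
  by case/andP: v => _ -> /=; rewrite all_nseq /valid_update /= orbT.
move=> vu vv; have := cA _ (padv _ vu); have := cA _ (padv _ vv).
rewrite !padE; set P := [pred w | _]; set Q := [pred w | _].
have W0 : 0 < #|coins A m|%:R :> R by rewrite ltr0n card_ffun expn_gt0 coin_gt0.
rewrite /prob !ler_pdivlMr // => cP cQ.
(* Both events have probability at least 3/4, hence a common point. *)
have [w /andP [Pw Qw]|PQ0] := pickP [predI P & Q].
  move: Pw Qw; rewrite !inE /answer !pads //.
  rewrite (st (run_from w 0 _ (pad us)) (run_from w 0 (init (w ord0)) (pad vs))).
  by move=> /andP [_ h2] /andP [h1 _]; apply: le_trans h2.
have := cardUI P Q; rewrite [#|[predI P & Q]|]eq_card0 // addn0 => cUI.
have : (#|[predU P & Q]| <= #|coins A m|)%N by apply: max_card.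
rewrite cUI -(ler_nat R) natrD; lra.
Qed.

Lemma constant_robust (y K eps : R) : 0 <= eps ->
  (forall us : seq (update n), valid_stream M m us -> is_approx K (F (freq R us)) y) ->
  exists A : algorithm R n, bits A = 0%N /\ robustly_correct M m F K eps A.
Proof.
move=> e0 Hy.
have u0 : (0 < #|{: unit}|)%N by rewrite card_unit.
pose A := @Algorithm R n unit unit u0 (fun=> tt) (fun _ _ _ => tt) (fun _ _ => y).
exists A.
split=> [|adv advP]; first by rewrite /bits card_unit up_log1.
rewrite /prob; set G := [pred w | _].
have -> : #|G| = #|coins A m|.
  apply: eq_card => w; rewrite !inE; apply/forallP => t.
  by apply: Hy; apply: valid_adaptive_stream.
by rewrite divff ?gerBl // pnatr_eq0 -lt0n card_ffun expn_gt0 coin_gt0.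
Qed.

End Constant.

Lemma up_log2_mul x y : (up_log 2 (x * y) <= up_log 2 x + up_log 2 y)%N.
Proof. by apply: up_log_min => //; rewrite expnD leq_mul // up_logP. Qed.

Lemma expn_homo x y k : (x <= y)%N -> (x ^ k <= y ^ k)%N.
Proof. by case: k => [//|k]; rewrite leq_exp2r. Qed.

Lemma up_log2_le x : (up_log 2 x <= x)%N.
Proof. by apply: up_log_min => //; apply/ltnW/ltn_expl. Qed.

Lemma up_log2_poly x k :
  (up_log 2 (x ^ k + k).+1 <= up_log 2 x.+1 * k + k.+1)%N.
Proof.
apply: up_log_min => //; rewrite expnD expnM.
have H1 : (x ^ k <= (2 ^ up_log 2 x.+1) ^ k)%N.
  by apply: expn_homo; apply: ltnW; apply: up_logP.
have H2 : (k < 2 ^ k)%N by apply: ltn_expl.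
have H3 : (0 < (2 ^ up_log 2 x.+1) ^ k)%N by rewrite !expn_gt0.
rewrite expnS; nia.
Qed.

Lemma up_log2_real (R : realType) n : (0 < n)%N ->
  (up_log 2 n.+1)%:R <= 2 * log2 n.+1%:R :> R.
Proof.
move=> n0; have l0 : 0 < ln 2 :> R by rewrite ln_gt0 // ltr1n.
have le_log k : (2 ^ k <= n.+1)%N -> k%:R <= log2 n.+1%:R :> R.
  move=> le_k; rewrite /log2 ler_pdivlMr // mulr_natl -lnXn //.
  by rewrite ler_ln ?posrE ?exprn_gt0 // -natrX ler_nat.
have /andP [lt_l _] := up_log_bounds (ltnSn 1) (n0 : (1 < n.+1)%N).
have l1 : (0 < up_log 2 n.+1)%N by rewrite up_log_gt0.
have h1 := le_log 1%N n0; have h2 := le_log _ (ltnW lt_l).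
move: h2; rewrite -[in X in _ -> X](prednK l1) -[X in _ -> X <= _]natr1; lra.
Qed.

(** As [e > C], [y = B ^ e] is at least [n], and also at least [k.+2]; thus
    [y ^ k.+1 >= k.+2 * n ^ k > n ^ k + k]. *)
Lemma base_gt (R : realType) (C : R) n k m : 1 < C -> (0 < n)%N ->
  (m <= n ^ k + k)%N ->
  (m < (k.+2 + Num.truncn (n%:R `^ C^-1)) ^ (k.+1 * (Num.truncn C).+1))%N.
Proof.
move=> C1 n0 le_m; set r := n%:R `^ C^-1; set B := (k.+2 + _)%N.
set e := (Num.truncn C).+1; set y := (B ^ e)%N.
have C0 : 0 < C by apply: lt_trans C1.
have n1 : 1 <= n%:R :> R by rewrite ler1n.
have r1 : 1 <= r by rewrite -(powRr0 n%:R) ler_powR // invr_ge0 ltW.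
have le_n : (n <= y)%N.
  rewrite -(ler_nat R) natrX; apply: (@le_trans _ _ (r ^+ e)); last first.
    rewrite lerXn2r ?nnegrE ?(le_trans ler01 r1) //.
    apply: ltW; apply: lt_le_trans (truncnS_gt r) _.
    by rewrite ler_nat /B addSn ltnS leq_addl.
  rewrite -powR_mulrn ?(le_trans ler01 r1) //.
  apply: (@le_trans _ _ (r `^ C)); last by rewrite ler_powR // ltW // truncnS_gt.
  by rewrite -powRrM mulVf ?gt_eqF // powRr1 // ler0n.
have le_k : (k.+2 <= y)%N.
  apply: (@leq_trans B); first exact: leq_addr.
  by rewrite /y /e expnS leq_pmulr ?expn_gt0.
rewrite mulnC expnM -/y expnS.
have H : (n ^ k <= y ^ k)%N by apply: expn_homo.
have H1 : (0 < n ^ k)%N by rewrite expn_gt0 n0.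
apply: (@leq_trans (k.+2 * n ^ k)); first by nia.
exact: leq_mul.
Qed.

Lemma base_le (R : realType) (C : R) n k : 1 < C -> (0 < n)%N ->
  (k.+2 + Num.truncn (n%:R `^ C^-1))%:R <= k.+3%:R * n%:R `^ C^-1 :> R.
Proof.
move=> C1 n0; set r := n%:R `^ C^-1.
have r1 : 1 <= r.
  by rewrite -(powRr0 n%:R) ler_powR ?ler1n // invr_ge0 ltW // (lt_trans ltr01).
rewrite natrD -[k.+3%:R]natr1 mulrDl mul1r lerD ?ler_peMr //.
by rewrite truncn_le (le_trans ler01).
Qed.

Lemma base_le_nat (R : realType) (C : R) n k : 1 < C -> (0 < n)%N ->
  (k.+2 + Num.truncn (n%:R `^ C^-1 : R) <= k.+2 + n)%N.
Proof.
move=> C1 n0; rewrite leq_add2l truncn_le_nat.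
apply: (@le_lt_trans _ _ n%:R); last by rewrite ltr_nat.
by rewrite ler1_powR ?ler1n // invf_le1 ?ltW // (lt_trans ltr01).
Qed.

Lemma bits_robust (R : realType) (n : nat) (A : algorithm R n) (h' B' q m : nat)
    (V : nat -> R) (beta F0 : R) :
  (bits (robust A h' B' q m V beta F0) <=
     h'.+1 * B'.+1 * q.+1 * bits A + h'.+1 * (up_log 2 m.+1 + q.+1))%N.
Proof.
rewrite /bits card_rstate; apply: leq_trans (up_log2_mul _ _) _; apply: leq_add.
  apply: up_log_min => //; rewrite [in leqRHS]mulnC [leqRHS]expnM; apply: expn_homo; exact: up_logP.
apply: up_log_min => //; rewrite [in leqRHS]mulnC [leqRHS]expnM; apply: expn_homo.
rewrite expnD leq_mul ?up_logP //; exact/ltnW/ltn_expl.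
Qed.

(** * Instantiation at a fixed dimension *)

Section Assembly.
Variables (R : realType) (n m M : nat) (F : 'rV[R]_n -> R).
Variables (S beta kappa : R) (k1 : nat).
Let P : R := (m ^ k1 + k1)%:R.
Hypothesis n0 : (0 < n)%N.
Hypotheses (symF : symmetric_fun F) (triF : approx_triangle beta F).
Hypothesis rangeF : forall us : seq (update n), valid_stream M m us ->
  P^-1 <= F (freq R us) <= P.
Hypotheses (beta0 : 0 < beta) (kappa_gt : 2 * beta + 1 < kappa).
Hypothesis sketches : forall delta : R, 0 < delta < 1 ->
  exists A : algorithm R n,
    (bits A)%:R <= S * log2 delta^-1 /\
    nonadaptive_correct M m F kappa delta A.

Lemma P_gt0 : 0 < P.
Proof. by rewrite ltr0n; case: k1 => [|k]; rewrite ?expn0 // addnS. Qed.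

Lemma F_gt0 us : valid_stream M m us -> 0 < F (freq R us).
Proof.
by move/rangeF => /andP [+ _]; apply: lt_le_trans; rewrite invr_gt0 P_gt0.
Qed.

(** At three equal points the triangle inequality reads [F 0 <= 2 * beta * F 0], and [F 0 > 0]. *)
Lemma beta_ge_half : 1 / 2 <= beta.
Proof.
have v : valid_stream M m ([::] : seq (update n)) by [].
have := triF 0 0 0; have := F_gt0 v; rewrite freq_nil subrr.
have -> : beta * (F 0 + F 0) = (2 * beta) * F 0 by ring.
by move=> F0; rewrite ler_pMl // => ?; lra.
Qed.

Lemma kappa_gt2 : 2 < kappa.
Proof. by have := beta_ge_half; have := kappa_gt; lra. Qed.

Lemma log2_expn D : log2 ((2 : R) ^- D)^-1 = D%:R.
Proof.
have l0 : 0 < ln 2 :> R by rewrite ln_gt0 // ltr1n.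
by rewrite invrK /log2 lnXn // -[ln 2 *+ D]mulr_natl mulfK // gt_eqF.
Qed.

(** At [delta = 1 / 4] the sketch has at most [2 * S < 1] bits, hence none, and [kappa * F 0] can
    always be answered. For such [S] the bookkeeping of [robust] could not be charged to [S]. *)
Lemma robust_small_space (K eps : R) : S < 1 / 2 -> kappa ^+ 2 <= K -> 0 <= eps ->
  exists A : algorithm R n, bits A = 0%N /\ robustly_correct M m F K eps A.
Proof.
move=> S_lt kK e0.
have [A []] : exists A : algorithm R n,
    (bits A)%:R <= S * log2 ((2 : R) ^- 2)^-1 /\
    nonadaptive_correct M m F kappa (2 ^- 2) A.
  by apply: sketches; lra.
rewrite log2_expn => bA; have -> : 2 ^- 2 = 1 / 4 :> R by lra.
move=> cA; have A0 : bits A = 0%N.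
  by apply/eqP; rewrite -leqn0 -ltnS -(ltr_nat R); lra.
have ratio := stateless_ratio n0 A0 cA.
have vn : valid_stream M m ([::] : seq (update n)) by [].
apply: (@constant_robust _ _ _ _ _ (kappa * F 0)) => // us v.
apply/andP; split; first by have := ratio _ _ v vn; rewrite freq_nil.
have := ratio _ _ vn v; rewrite freq_nil => r.
have k0 : 0 <= kappa by have := kappa_gt2; lra.
apply: (@le_trans _ _ (kappa ^+ 2 * F (freq R us))).
  by rewrite expr2 -mulrA ler_wpM2l.
by rewrite ler_wpM2r // ltW // F_gt0.
Qed.

(** Enough doublings to lead from [P^-1] past [kappa * P], the largest possible approximation. *)
Definition depth_exponents : nat :=
  (2 * up_log 2 (m ^ k1 + k1).+1 + up_log 2 (Num.truncn kappa).+1)%N.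
Local Notation q := depth_exponents.

(** Sketches fail with probability [2 ^- D]: the first two terms of [D] pay for the target
    [n%:R ^- d] and for the union bound, and the 1 keeps the probability below 1. *)
Lemma robust_exists (h' B' d : nat) :
  let slots := (h'.+1 * B'.+1 * q.+1)%N in
  let D := (d * up_log 2 n.+1 + up_log 2 (slots * m.+1 ^ 2) + 1)%N in
  (m < B'.+1 ^ h'.+1)%N ->
  exists A : algorithm R n,
    (bits A)%:R <= slots%:R * (S * D%:R) + (h'.+1 * (up_log 2 m.+1 + q.+1))%:R /\
    robustly_correct M m F (kappa ^+ (4 * h'.+1)) (n%:R ^- d) A.
Proof.
move=> slots D mB.
have k2 := kappa_gt2; have P0 := P_gt0.
have [A []] : exists A : algorithm R n,
    (bits A)%:R <= S * log2 ((2 : R) ^- D)^-1 /\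
    nonadaptive_correct M m F kappa (2 ^- D) A.
  apply: sketches; rewrite invr_gt0 exprn_gt0 //= invf_lt1 ?exprn_gt0 //.
  by rewrite exprn_egt1 ?ltr1n // /D addn1.
rewrite log2_expn => bA cA.
exists (robust A h' B' q m (fun j => 2 ^+ j / P) beta (F 0)); split.
  apply: (@le_trans _ _ (slots * bits A + h'.+1 * (up_log 2 m.+1 + q.+1))%:R).
    by rewrite ler_nat bits_robust.
  by rewrite natrD natrM lerD2r ler_wpM2l.
apply: (robust_robustly_correct symF triF beta_ge_half kappa_gt _ _ _ _ F_gt0 mB cA) => //.
- by move=> j; rewrite exprS mulrA.
- move=> us v y /andP [y1 y2]; have /andP [f1 f2] := rangeF v; split.
    rewrite ler_pdivlMr //.
    apply: (@le_trans _ _ (kappa * P * P)).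
      by rewrite ler_wpM2r ?(ltW P0) // (le_trans y2) // ler_wpM2l //; lra.
    have hP : P <= 2 ^+ up_log 2 (m ^ k1 + k1).+1.
      by rewrite -natrX ler_nat ltnW // up_logP.
    have hk : kappa <= 2 ^+ up_log 2 (Num.truncn kappa).+1.
      apply: (le_trans (ltW (truncnS_gt kappa))).
      by rewrite -natrX ler_nat up_logP.
    rewrite /depth_exponents exprD mulnC exprM expr2 mulrC.
    apply: (le_trans (_ : _ <= P * (P * kappa))); first by rewrite [kappa * P]mulrC.
    rewrite -mulrA; have P0' := ltW P0.
    by rewrite !ler_pM ?mulr_ge0 //; lra.
  by rewrite expr0 mul1r; have := F_gt0 v; lra.
- by rewrite expr0 mul1r invr_gt0.
- rewrite -[X in _ * X]mul1r mulrA ler_pdivrMr ?exprn_gt0 //.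
  rewrite mulr1 mulrC ler_pdivlMr ?exprn_gt0 ?ltr0n // -!natrX -natrM ler_nat.
  rewrite !card_prod !card_ord -/slots {1}/D addn1 [leqRHS]expnS expnD.
  have H1 : (slots * m.+1 ^ 2 <= 2 ^ up_log 2 (slots * m.+1 ^ 2))%N by apply: up_logP.
  have H2 : (n ^ d <= 2 ^ (d * up_log 2 n.+1))%N.
    by rewrite mulnC expnM; apply: expn_homo; apply/ltnW/up_logP.
  apply: leq_trans (leq_pmull _ _) => //.
  by rewrite mulnC leq_mul.
Qed.

End Assembly.

Lemma robustly_correct_le (R : realType) (n M m : nat) (F : 'rV[R]_n -> R)
    (K K' eps : R) (A : algorithm R n) : K <= K' ->
  (forall us : seq (update n), valid_stream M m us -> 0 <= F (freq R us)) ->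
  robustly_correct M m F K eps A -> robustly_correct M m F K' eps A.
Proof.
move=> KK' F0 rA adv advP; apply: le_trans (rA adv advP) _.
rewrite ler_wpM2r ?invr_ge0 ?ler0n // ler_nat; apply: subset_leq_card.
apply/subsetP => w; rewrite !inE => /forallP H; apply/forallP => t.
have /andP [h1 h2] := H t; apply/andP; split=> //; apply: le_trans h2 _.
by rewrite ler_wpM2r // F0 // valid_adaptive_stream.
Qed.

(** One logarithm comes from the number of exponents, one from [D]. The factor [B] of the number of
    slots is left out here, and [B] enters only through its logarithm. *)
Lemma overhead_bound (h k0 k1 kk d : nat) :
  exists K : nat, forall n m B q : nat, (0 < n)%N -> (m <= n ^ k0 + k0)%N ->
    (B <= k0.+2 + n)%N -> q = (2 * up_log 2 (m ^ k1 + k1).+1 + kk)%N ->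
    (h * q.+1 * (d * up_log 2 n.+1 + up_log 2 (h * B * q.+1 * m.+1 ^ 2) + 1) +
       2 * (h * (up_log 2 m.+1 + q.+1)) <= K * up_log 2 n.+1 ^ 2)%N.
Proof.
pose A1 := (2 * k0 + 1)%N; pose Q1 := (2 * (A1 * k1 + k1.+1) + kk + 1)%N.
pose D1 := (d + h + k0.+2 + 2 + Q1 + 2 * A1)%N.
exists (h * Q1 * D1 + 2 * (h * (A1 + Q1)))%N => n m B q n0 le_m le_B qE.
set X := up_log 2 n.+1; have X1 : (1 <= X)%N by rewrite /X up_log_gt0.
set a := up_log 2 m.+1.
have Ha : (a <= A1 * X)%N.
  have := up_log2_poly n k0; have : (a <= up_log 2 (n ^ k0 + k0).+1)%N.
    by apply: leq_up_log.
  by rewrite -/X /A1; nia.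
have Hq : (q.+1 <= Q1 * X)%N.
  by have := up_log2_poly m k1; rewrite -/a qE /Q1; nia.
have HB : (up_log 2 B <= k0.+2 + X)%N.
  apply: up_log_min => //; rewrite expnD.
  have H1 : (k0.+2 < 2 ^ k0.+2)%N by apply: ltn_expl.
  have H2 : (n.+1 <= 2 ^ X)%N by apply: up_logP.
  by nia.
set u := up_log 2 (_ * _ ^ 2).
have Hu : (u <= h + (k0.+2 + X) + q.+1 + 2 * a)%N.
  apply: leq_trans (up_log2_mul _ _) _; apply: leq_add; last first.
    by rewrite mul2n -addnn -mulnn; apply: up_log2_mul.
  apply: leq_trans (up_log2_mul _ _) _; apply: leq_add (up_log2_le _).
  apply: leq_trans (up_log2_mul _ _) _; apply: leq_add HB; exact: up_log2_le.
have HD : (d * X + u + 1 <= D1 * X)%N by rewrite /D1; nia.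
rewrite mulnDl; apply: leq_add.
  have -> : (h * Q1 * D1 * X ^ 2 = h * (Q1 * X) * (D1 * X))%N by ring.
  by rewrite leq_mul // leq_mul.
have -> : (2 * (h * (A1 + Q1)) * X ^ 2 = 2 * (h * ((A1 * X + Q1 * X) * X)))%N by ring.
rewrite !leq_mul // -[leqLHS]muln1 leq_mul //; exact: leq_add.
Qed.

(* The constant c hidden in kappa^O(C) depends only on the stream length m;
   "high probability" is 1 - 1/n^d for an arbitrary fixed d. *)
Theorem theorem1p5 (R : realType) (m : nat -> nat) (hm : poly_bounded m) :
  exists c : R,
  forall (M : nat -> nat) (F : forall n : nat, 'rV[R]_n -> R) (S : nat -> R)
    (beta kappa : R),
  poly_bounded M ->
  (forall n : nat, (0 < n)%N -> symmetric_fun (F n)) ->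
  poly_range M m F ->
  0 < beta ->
  (forall n : nat, (0 < n)%N -> approx_triangle beta (F n)) ->
  2 * beta + 1 < kappa ->
  (forall n : nat, (0 < n)%N -> forall delta : R, 0 < delta < 1 ->
    exists A : algorithm R n,
      (bits A)%:R <= S n * log2 delta^-1 /\
      nonadaptive_correct (M n) (m n) (F n) kappa delta A) ->
  forall C : R, 1 < C -> forall d : nat,
  exists g : nat -> R,
    softO g (fun n => n%:R `^ C^-1) /\
    forall n : nat, (0 < n)%N ->
    exists A : algorithm R n,
      (bits A)%:R <= g n * S n /\
      robustly_correct (M n) (m n) (F n) (kappa `^ (c * C)) (n%:R ^- d) A.
Proof.
(* [4 * h <= 8 * k0.+1 * C], because [truncn C + 1 <= 2 * C] for [C > 1]. *)
have [k0 m_le] := hm; exists (8 * k0.+1)%:R.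
move=> M F S beta kappa _ symF [k1 rangeF] beta0 triF kappa_gt sketches C C1 d.
pose h := (k0.+1 * (Num.truncn C).+1)%N.
have hE : h = h.-1.+1 by [].
have [K HK] := overhead_bound h k0 k1 (up_log 2 (Num.truncn kappa).+1) d.
(* [k0.+3] comes from [base_le], and 4 from [(2 * log2 n.+1%:R) ^+ 2]. *)
pose g n : R := (4 * k0.+3 * K)%:R * n%:R `^ C^-1 * log2 n.+1%:R ^+ 2.
exists g; split; first by exists (4 * k0.+3 * K)%:R, 2%N.
move=> n n0; have rangeFn := rangeF n n0.
have sk := sketches n n0.
have k2 := kappa_gt2 (triF n n0) rangeFn kappa_gt.
have F0 us v := ltW (F_gt0 rangeFn (us := us) v).
have le_K : kappa ^+ (4 * h) <= kappa `^ ((8 * k0.+1)%:R * C).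
  rewrite -powR_mulrn; last by lra.
  apply: ler_powR; first by lra.
  have tC : (Num.truncn C)%:R <= C by rewrite truncn_le; lra.
  have -> : (4 * h = 4 * k0.+1 * (Num.truncn C).+1)%N by rewrite /h mulnA.
  have -> : (8 * k0.+1 = 4 * k0.+1 * 2)%N by lia.
  rewrite [in leLHS]natrM [in leRHS]natrM -mulrA ler_wpM2l // -natr1; lra.
have eps0 : 0 <= n%:R ^- d :> R by rewrite invr_ge0 exprn_ge0.
have log0 : 0 <= log2 n.+1%:R :> R.
  have := up_log2_real R n0; have : 0 <= (up_log 2 n.+1)%:R :> R by [].
  lra.
have r0 : 0 <= n%:R `^ C^-1 :> R by apply: powR_ge0.
(* When [S n >= 1 / 2], the additive bookkeeping [E] is at most [2 * E * S n], whence the factor 2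
   in [overhead_bound]. *)
have [S_lt|S_ge] := ltP (S n) (1 / 2).
  have S0 : 0 <= S n.
    have [A [bA _]] := sk (2 ^- 1) ltac:(by lra).
    by move: bA; rewrite log2_expn mulr1; apply: le_trans.
  have [||A [A0 rA]] := @robust_small_space _ _ _ _ _ _ _ _ _ n0 (triF n n0)
      rangeFn kappa_gt sk (kappa `^ ((8 * k0.+1)%:R * C)) (n%:R ^- d) S_lt.
  - apply: le_trans le_K; apply: ler_weXn2l; first by lra.
    by rewrite /h; lia.
  - exact: eps0.
  exists A; split=> //; rewrite A0; apply: mulr_ge0 => //.
  by apply: mulr_ge0; [exact: mulr_ge0|exact: exprn_ge0].
pose B' := (k0.+1 + Num.truncn (n%:R `^ C^-1 : R))%N.
have mB : (m n < B'.+1 ^ h.-1.+1)%N by rewrite -hE; apply: base_gt.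
have [A [bA rA]] := robust_exists n0 (symF n n0) (triF n n0) rangeFn kappa_gt sk d mB.
exists A; split; last by apply: robustly_correct_le F0 rA.
apply: le_trans bA _; rewrite -hE.
set q := depth_exponents _ _ _; set D := (_ + 1)%N; set E := (h * (_ + _))%N.
set X := up_log 2 n.+1.
have HKn : (h * q.+1 * D + 2 * E <= K * X ^ 2)%N.
  by apply: HK => //; apply: base_le_nat.
have H : (h * B'.+1 * q.+1 * D + 2 * E <= B'.+1 * (K * X ^ 2))%N by nia.
have HX : X%:R <= 2 * log2 n.+1%:R :> R by apply: up_log2_real.
have HB : B'.+1%:R <= k0.+3%:R * n%:R `^ C^-1 :> R by apply: base_le.
have S0 : 0 <= S n by lra.
apply: (@le_trans _ _ (S n * (h * B'.+1 * q.+1 * D + 2 * E)%:R)).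
  have : 0 <= E%:R :> R by [].
  rewrite natrD [(2 * E)%:R]natrM [(h * B'.+1 * q.+1 * D)%:R]natrM; nra.
apply: (@le_trans _ _ (S n * (B'.+1 * (K * X ^ 2))%:R)).
  by rewrite ler_wpM2l // ler_nat.
rewrite [leRHS]mulrC ler_wpM2l // natrM.
apply: (@le_trans _ _ (k0.+3%:R * n%:R `^ C^-1 * (K%:R * (2 * log2 n.+1%:R) ^+ 2))).
  rewrite ler_pM // natrM natrX ler_wpM2l //.
  by rewrite lerXn2r ?nnegrE //; apply: mulr_ge0.
rewrite /g !natrM le_eqVlt; apply/orP; left; apply/eqP; ring.
Qed.
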